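(* Let $G=(S,\mathcal{F})$ be a greedoid with set of bases $\mathcal{B}$ and $w_G:\mathcal{F}\rightarrow\mathbb{R}$ an objective function. Assume that $w_G$ violates the following condition: whenever $A\subseteq B$, $A\in\mathcal{F}$, $B\in\mathcal{B}$, $x\in S-B$, $A+x\in\mathcal{F}$, and $w_G(A+x)\ge w_G(A+u)$ for every $u\in\Gamma(A)$, there exists a $y\in B-A$ such that $B-y+x\in\mathcal{B}$ and $w_G(B-y+x)\ge w_G(B)$. Then there exists a minor $H$ of $G$ such that a legal run of the greedy algorithm on $H$ with objective function $w_H$ gives a base of $H$ that is not maximum with respect to $w_H$.
   Context: Notation: $X+x=X\cup\{x\}$, $X-x=X\setminus\{x\}$, $X-Y=X\setminus Y$. A greedoid $G=(S,\mathcal{F})$ consists of a finite ground set $S$ and a family $\mathcal{F}\subseteq 2^S$ (the feasible sets) such that $\emptyset\in\mathcal{F}$, and whenever $X,Y\in\mathcal{F}$ with $|X|<|Y|$ there is $y\in Y-X$ with $X+y\in\mathcal{F}$. A base of $G$ is a feasible set of maximum size; $\mathcal{B}$ denotes the set of bases. For $A\in\mathcal{F}$, the set of continuations is $\Gamma(A)=\{x\in S-A : A+x\in\mathcal{F}\}$. Minors with objective functions: for $X\subseteq S$, the deletion of $X$ is the greedoid $G\setminus X=(S-X,\{Y\subseteq S-X : Y\in\mathcal{F}\})$, with objective function $w_{G\setminus X}$ the restriction of $w_G$ to the feasible sets contained in $S-X$. For $X\in\mathcal{F}$, the contraction of $X$ is the greedoid $G/X=(S-X,\{Y\subseteq S-X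 : Y\cup X\in\mathcal{F}\})$, with objective function $w_{G/X}(A)=w_G(A\cup X)$. A minor $H$ of $G$ is a greedoid obtained from $G$ by applying these operations (successively), and $w_H$ is the objective function correspondingly obtained from $w_G$. Greedy algorithm (for maximizing an objective function $w$ over the bases of a greedoid): start with $A=\emptyset$. While $\Gamma(A)\ne\emptyset$, choose an $x\in\Gamma(A)$ such that $w(A+x)\ge w(A+y)$ for every $y\in\Gamma(A)$ (ties broken arbitrarily) and replace $A$ by $A+x$. When $\Gamma(A)=\emptyset$, stop and output $A$. A legal run is any run consistent with these rules. A base is maximum with respect to $w$ if it has the largest $w$-value among all bases. *)

(* Defs.v *)
From mathcomp Require Import all_boot all_order all_algebra.
From mathcomp Require Import reals.

Set Implicit Arguments.
Unset Strict Implicit.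
Unset Printing Implicit Defensive.

Import Order.TTheory GRing.Theory Num.Theory.
Local Open Scope ring_scope.

(* The ground set is a subset of a fixed finite type, so that a minor, whose   *)
(* ground set is smaller, is a greedoid over the same type.                    *)
Record greedoid (T : finType) := Greedoid {
  ground : {set T};
  feasible : {set {set T}};
  feasible_sub : forall X, X \in feasible -> X \subset ground;
  feasible0 : set0 \in feasible;
  feasible_exch : forall X Y, X \in feasible -> Y \in feasible ->
    (#|X| < #|Y|)%N -> exists2 y, y \in Y :\: X & y |: X \in feasible }.

Definition bases (T : finType) (G : greedoid T) : {set {set T}} :=
  [set B in feasible G | [forall X in feasible G, #|X| <= #|B|]%N].

Definition continuations (T : finType) (G : greedoid T) (A : {set T}) :
    {set T} :=
  [set x in ground G :\: A | x |: A \in feasible G].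

Section Deletion.
Variables (T : finType) (G : greedoid T) (X : {set T}).

Let F := [set Y in feasible G | Y \subset ground G :\: X].

Lemma deletion_sub Y : Y \in F -> Y \subset ground G :\: X.
Proof. by rewrite inE => /andP[]. Qed.

Lemma deletion0 : set0 \in F.
Proof. by rewrite inE feasible0 sub0set. Qed.

Lemma deletion_exch Y Z : Y \in F -> Z \in F -> (#|Y| < #|Z|)%N ->
  exists2 z, z \in Z :\: Y & z |: Y \in F.
Proof.
rewrite !inE => /andP[FY sY] /andP[FZ sZ] /(feasible_exch FY FZ)[z zZY FzY].
exists z => //; rewrite inE FzY subUset sub1set sY andbT.
by move: zZY; rewrite inE => /andP[_ /(subsetP sZ)].
Qed.

Definition deletion : greedoid T :=
  Greedoid deletion_sub deletion0 deletion_exch.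

End Deletion.

Section Contraction.
Variables (T : finType) (G : greedoid T) (X : {set T}).
Hypothesis FX : X \in feasible G.

Let F := [set Y : {set T} | (Y \subset ground G :\: X) &&
                            (Y :|: X \in feasible G)].

Lemma contraction_sub Y : Y \in F -> Y \subset ground G :\: X.
Proof. by rewrite inE => /andP[]. Qed.

Lemma contraction0 : set0 \in F.
Proof. by rewrite inE sub0set set0U. Qed.

Lemma contraction_exch Y Z : Y \in F -> Z \in F -> (#|Y| < #|Z|)%N ->
  exists2 z, z \in Z :\: Y & z |: Y \in F.
Proof.
rewrite !inE => /andP[sY FY] /andP[sZ FZ] ltYZ.
have disj (W : {set T}) : W \subset ground G :\: X -> #|W :|: X| = (#|W| + #|X|)%N.
  rewrite subsetD => /andP[_ dWX].
  by rewrite cardsU (disjoint_setI0 dWX) cards0 subn0.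
have [|z] := feasible_exch FY FZ; first by rewrite !disj // ltn_add2r.
rewrite !inE negb_or => /andP[/andP[zY zX]]; rewrite (negPf zX) orbF => zZ FzY.
exists z; first by rewrite inE zY.
by rewrite inE subUset sub1set sY (subsetP sZ) // -setUA FzY.
Qed.

Definition contraction : greedoid T :=
  Greedoid contraction_sub contraction0 contraction_exch.

End Contraction.

(* An objective function is a total function on {set T}; its values on         *)
(* infeasible sets are never used. Hence deletion, which restricts the         *)
(* objective function to fewer feasible sets, leaves it unchanged here.        *)
Inductive minor (R : realType) (T : finType) (G : greedoid T)
    (w : {set T} -> R) : greedoid T -> ({set T} -> R) -> Prop :=
| minor_refl : minor G w G w
| minor_deletion H wH (X : {set T}) :
    minor G w H wH -> X \subset ground H -> minor G w (deletion H X) wH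
| minor_contraction H wH (X : {set T}) (FX : X \in feasible H) :
    minor G w H wH -> minor G w (contraction FX) (fun A => wH (A :|: X)).

Definition greedy_choice (R : realType) (T : finType) (G : greedoid T)
    (w : {set T} -> R) (A : {set T}) (x : T) : bool :=
  (x \in continuations G A) &&
  [forall y in continuations G A, w (y |: A) <= w (x |: A)].

(* A run is recorded as the sequence p of values taken by the current set      *)
(* after its initial value set0; its output is last set0 p.                    *)
Definition legal_run (R : realType) (T : finType) (G : greedoid T)
    (w : {set T} -> R) (p : seq {set T}) : bool :=
  path (fun A A' => [exists x, greedy_choice G w A x && (A' == x |: A)])
       set0 p
  && (continuations G (last set0 p) == set0).

Definition maximum_base (R : realType) (T : finType) (G : greedoid T)
    (w : {set T} -> R) (B : {set T}) : Prop :=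
  B \in bases G /\ forall B', B' \in bases G -> w B' <= w B.

Definition greedy_exchange (R : realType) (T : finType) (G : greedoid T)
    (w : {set T} -> R) : Prop :=
  forall (A B : {set T}) (x : T),
    A \subset B -> A \in feasible G -> B \in bases G ->
    x \in ground G :\: B -> x |: A \in feasible G ->
    (forall u, u \in continuations G A -> w (u |: A) <= w (x |: A)) ->
  exists y, [/\ y \in B :\: A, x |: (B :\ y) \in bases G
              & w B <= w (x |: (B :\ y))].

(* Main.v *)
Require Import Defs.
From mathcomp Require Import all_boot all_order all_algebra.
From mathcomp Require Import reals boolp.

(** Let [A], [B], [x] violate the exchange condition, contract [A] and delete
    everything outside of [B + x]. In the resulting minor [B - A] is a base and
    [x] is a legal first choice. Every base containing [x] misses exactly one
    element [y] of [(B - A) + x], with [y] in [B - A], so the greedy run starting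
    with [x] outputs some [B - A - y + x], whose value is that of [B - y + x],
    hence smaller than the value of [B - A]. *)

Set Implicit Arguments.
Unset Strict Implicit.
Unset Printing Implicit Defensive.

Import Order.TTheory GRing.Theory Num.Theory.
Local Open Scope ring_scope.

(** A larger feasible set would yield a continuation of [A] through the exchange axiom. *)
Lemma continuations0_base (T : finType) (G : greedoid T) (A : {set T}) :
  A \in feasible G -> continuations G A = set0 -> A \in bases G.
Proof.
move=> FA cA0; rewrite inE FA; apply/forall_inP => Y FY.
rewrite leqNgt; apply/negP => /(feasible_exch FA FY)[y].
rewrite inE => /andP[yA yY] FyA.
have: y \in continuations G A.
  by rewrite !inE yA FyA (subsetP (feasible_sub FY)).
by rewrite cA0 inE.
Qed.

Lemma bases_card (T : finType) (G : greedoid T) (B C : {set T}) :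
  B \in bases G -> C \in bases G -> #|B| = #|C|.
Proof.
rewrite !inE => /andP[FB /forall_inP maxB] /andP[FC /forall_inP maxC].
by apply/eqP; rewrite eqn_leq maxB ?maxC.
Qed.

Lemma feasible_card_base (T : finType) (G : greedoid T) (B C : {set T}) :
  B \in bases G -> C \in feasible G -> #|C| = #|B| -> C \in bases G.
Proof. by rewrite !inE => /andP[_ maxB] -> ->. Qed.

(** Starting from an arbitrary feasible set rather than [set0] lets the first greedy choice be
    prescribed. Each step shrinks the complement of the current set, so the run ends. *)
Lemma greedy_completion (R : realType) (T : finType) (G : greedoid T)
    (w : {set T} -> R) (A : {set T}) : A \in feasible G ->
  exists p, [/\ path (fun A A' =>
                  [exists x, greedy_choice G w A x && (A' == x |: A)]) A p,
    continuations G (last A p) = set0, last A p \in feasible G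
    & A \subset last A p].
Proof.
have [n] := ubnP #|~: A|; elim: n A => // n IHn A ltAn FA.
have [cA0|[z zA]] := set_0Vmem (continuations G A); first by exists [::].
pose x := [arg max_(y > z in continuations G A) w (y |: A)]%O.
have [xA maxx] : x \in continuations G A /\
    forall y, y \in continuations G A -> w (y |: A) <= w (x |: A).
  by rewrite /x; case: arg_maxP.
have [] : x \notin A /\ x |: A \in feasible G.
  by move: xA; rewrite !inE => /andP[/andP[]].
move=> nxA FxA; have [|p [pathp clast Flast sublast]] := IHn (x |: A) _ FxA.
  move: ltAn; rewrite ltnS; apply: leq_trans; apply: proper_card.
  by rewrite properC properE subsetUr subUset sub1set negb_and nxA.
exists ((x |: A) :: p); split=> //=; last first.
  by apply: subset_trans sublast; exact: subsetUr.
rewrite pathp andbT; apply/existsP; exists x; rewrite eqxx andbT.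
by rewrite /greedy_choice xA; apply/forall_inP.
Qed.

(** By cardinality [C] omits exactly one element of [x |: D], and that element is not [x]. *)
Lemma subset_card_exchange (T : finType) (D C : {set T}) (x : T) :
  x \in C -> x \notin D -> C \subset x |: D -> #|C| = #|D| ->
  exists2 y, y \in D & C = x |: (D :\ y).
Proof.
move=> xC xD sCD cardC.
have /subsetPn[y yD yC] : ~~ (D \subset C).
  apply: contra xD => sDC; suff -> : D = C by [].
  by apply/eqP; rewrite eqEcard sDC cardC leqnn.
exists y => //; apply/eqP; rewrite eqEcard; apply/andP; split.
  apply/subsetP => z zC; move: (subsetP sCD z zC).
  rewrite !inE => /orP[-> //|->]; rewrite andbT orbC.
  by have [zy|] := eqVneq z y; first by rewrite -zy zC in yC.
by rewrite cardsU1 !inE (negPf xD) andbF add1n cardC (cardsD1 y D) yD.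
Qed.

Theorem theorem14 (R : realType) (T : finType) (G : greedoid T)
    (w : {set T} -> R) (hw : ~ greedy_exchange G w) :
  exists (H : greedoid T) (wH : {set T} -> R),
    minor G w H wH /\
    exists p : seq {set T},
      [/\ legal_run H wH p,
          last set0 p \in bases H
        & ~ maximum_base H wH (last set0 p)].
Proof.
(* Arguing by contradiction, an exchange element is built for arbitrary [A], [B], [x]; the absence
   of a bad minor serves only for the final inequality of values. *)
apply: contrapT => noH; apply: hw => A B x sAB FA baseB.
rewrite inE => /andP[xB xG] FxA maxx.
have [FB maxB] : B \in feasible G /\
    forall X, X \in feasible G -> (#|X| <= #|B|)%N.
  by move: baseB; rewrite inE => /andP[FB /forall_inP].
have xA : x \notin A by apply: contra xB; exact: (subsetP sAB).
pose G1 := contraction FA.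
pose H := deletion G1 (ground G1 :\: (x |: B)).
pose wH (Y : {set T}) := w (Y :|: A).
have minorH : minor G w H wH.
  apply: minor_deletion; last exact: subsetDl.
  by apply: (minor_contraction (wH := w)); exact: minor_refl.
(* Containment in the ground set of [G] follows from feasibility of [Y :|: A], so these two
   conditions suffice. *)
have FH Y : (Y \in feasible H) =
    (Y :|: A \in feasible G) && (Y \subset (x |: B) :\: A).
  rewrite /= !inE /= setDDr setDv set0U.
  apply/idP/idP.
    move=> /andP[/andP[sY ->]] /subsetP sY' /=; apply/subsetP => z /sY'.
    by rewrite !inE => /andP[/andP[-> _]].
  move=> /andP[FYA /subsetP sY].
  have sYG : Y \subset ground G :\: A.
    apply/subsetP => z zY; move: (sY z zY); rewrite !inE => /andP[-> _] /=.
    by apply: (subsetP (feasible_sub FYA)); rewrite inE zY.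
  rewrite sYG FYA subsetI sYG; apply: subset_trans (subsetDl (x |: B) A).
  exact/subsetP.
have cardUA (Y : {set T}) : Y \in feasible H -> #|Y :|: A| = (#|Y| + #|A|)%N.
  rewrite FH subsetD => /andP[_ /andP[_ dYA]].
  by rewrite cardsU (disjoint_setI0 dYA) cards0 subn0.
have BAA : (B :\: A) :|: A = B.
  by rewrite setUC setDE setUIr setUCr setIT; exact/setUidPr.
have FBA : B :\: A \in feasible H.
  by rewrite FH BAA FB setSD ?subsetUr.
have baseBA : B :\: A \in bases H.
  rewrite inE FBA; apply/forall_inP => Y FY.
  rewrite -(leq_add2r #|A|) -!cardUA // BAA; apply: maxB.
  by move: FY; rewrite FH => /andP[].
have FxH : [set x] \in feasible H.
  by rewrite FH FxA sub1set !inE xA eqxx.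
(* The run is continued greedily after the first choice [x]; its output [C] determines the element
   [y] to exchange. *)
have [p [pathp cp Fp xp]] := greedy_completion wH FxH.
set C := last _ p in cp Fp xp.
have baseC : C \in bases H by exact: continuations0_base.
have [y yBA eqC] : exists2 y, y \in B :\: A & C = x |: ((B :\: A) :\ y).
  apply: subset_card_exchange; first by rewrite -sub1set.
  - by rewrite inE negb_and xB orbT.
  - move: Fp; rewrite FH => /andP[_ /subset_trans]; apply.
    by apply/subsetP => z; rewrite !inE => /andP[-> /=].
  - exact: bases_card baseC baseBA.
have yA : y \notin A by move: yBA; rewrite inE => /andP[].
have CA : C :|: A = x |: (B :\ y).
  rewrite eqC -setUA; congr (_ |: _); rewrite -[in RHS]BAA setDUl.
  by congr (_ :|: _); rewrite (setDidPl _) // disjoint_sym disjoints1.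
exists y; split=> //.
  (* Feasibility of [C] in the contraction makes [C :|: A] feasible in [G], and it has the size of
     [B] because [C] and [B :\: A] are both bases of [H]. *)
  rewrite -CA; apply: (feasible_card_base baseB).
    by move: Fp; rewrite FH => /andP[].
  by rewrite cardUA // (bases_card baseC baseBA) -cardUA // BAA.
(* If the exchange lost value, the run through [[set x]] to [C] would end strictly below the base
   [B :\: A]. *)
rewrite leNgt; apply/negP => ltw; apply: noH.
exists H, wH; split=> //; exists ([set x] :: p); split=> //=.
  rewrite /legal_run /= pathp -/C cp eqxx !andbT; apply/existsP; exists x.
  rewrite setU0 eqxx andbT; apply/andP; split.
    have := feasible_sub FxH; rewrite sub1set => xH.
    by rewrite inE setD0 setU0 FxH xH.
  (* Continuations of [set0] in [H] are continuations of [A] in [G], so the maximality of [x]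
     carries over. *)
  apply/forall_inP => u; rewrite inE !setU0 => /andP[_].
  rewrite FH sub1set => /andP[FuA]; rewrite inE => /andP[uA _].
  apply: maxx; rewrite !inE uA FuA andbT /=.
  by apply: (subsetP (feasible_sub FuA)); rewrite !inE eqxx.
by case=> _ /(_ _ baseBA); rewrite /wH -/C BAA CA leNgt ltw.
Qed.
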